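(* Let $T=(T_1,\ldots,T_n)\in B(H)^n$ be a commuting tuple. Suppose that $T$ is finitely generated and $\gamma$-graded. (a) Then the map $W\mapsto [W]=\bigvee_{k\in\mathbb N^n}T^kW$ defines a bijection between the homogeneous wandering subspaces of $T$ and the homogeneous closed $T$-invariant subspaces of $H$, with inverse acting as $M\mapsto W_T(M)=M\ominus\sum_{i=1}^nT_iM$. (b) Each homogeneous wandering subspace $W$ for $T$ is finite dimensional. If $M\subset H$ is a homogeneous closed $T$-invariant subspace, then the restriction $T|M=(T_1|M,\ldots,T_n|M)\in B(M)^n$ is $N$-cyclic with $N=\dim W_T(M)=\dim\big(M\ominus\sum_{i=1}^nT_iM\big)$.
   Context: $\mathbb N=\{0,1,2,\ldots\}$, $\mathbb C[z]=\mathbb C[z_1,\ldots,z_n]$. $H$ is a complex Hilbert space with a fixed orthogonal decomposition into closed subspaces $H_k$ ($k\in\mathbb N$), i.e. $H$ is the Hilbert space orthogonal direct sum of the $H_k$. Let $\gamma=(\gamma_1,\ldots,\gamma_n)$ be a tuple of integers $\gamma_i>0$. A commuting tuple $T\in B(H)^n$ of bounded linear operators is of degree $\gamma$ if $T_iH_k\subset H_{k+\gamma_i}$ for all $k\in\mathbb N$, $i=1,\ldots,n$. $T$ is called finitely generated and $\gamma$-graded if it is of degree $\gamma$ and satisfies one of the following conditions, which are equivalent for tuples of degree $\gamma$: (i) $H$ is the smallest closed $T$-invariant subspace containing some finite set $\{x_1,\ldots,x_\ell\}\subset H$; (ii) $\dim\big(H\ominus\sum_{i=1}^nT_iH\big)<\infty$;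 (iii) the algebraic direct sum $\tilde H=\bigoplus_{k\ge0}H_k$ is a finitely generated $\mathbb C[z]$-module with respect to $(p,x)\mapsto p(T)x$. A closed subspace $M\subset H$ is homogeneous if $M$ is the closed linear span of the spaces $M\cap H_k$ ($k\in\mathbb N$). A closed subspace $M$ is $T$-invariant if $T_iM\subset M$ for all $i$. A closed subspace $W\subset H$ is a wandering subspace for $T$ if $W\perp T^kW$ for all $k\in\mathbb N^n\setminus\{0\}$. $\bigvee$ denotes closed linear span. $M\ominus\sum_iT_iM$ is the orthogonal complement of $\sum_iT_iM$ in $M$. For a natural number $N\geq 1$, a commuting tuple $S\in B(K)^n$ on a Hilbert space $K$ is called $N$-cyclic if there is a tuple $(x_1,\ldots,x_N)\in K^N$ such that $K$ is the closed linear span of $\{p(S)x_i:\ p\in\mathbb C[z],\ i=1,\ldots,N\}$ and if $N$ is the minimal natural number with this property. *)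

(* Defs.v *)
From HB Require Import structures.
From mathcomp Require Import all_boot all_order all_algebra.
From mathcomp Require Import all_classical all_reals all_analysis.
From mathcomp Require Import complex.
From mathcomp.multinomials Require mpoly.

Set Implicit Arguments.
Unset Strict Implicit.
Unset Printing Implicit Defensive.

Import Order.TTheory GRing.Theory Num.Theory.
Import numFieldNormedType.Exports.

Local Open Scope classical_set_scope.
Local Open Scope ring_scope.
Local Open Scope complex_scope.

(* The inner product is linear in the first argument, and the norm of a normed
   module over R[i] takes its (nonnegative real) values in R[i]. *)
HB.mixin Record CompleteNormedModule_isHilbert (R : realType) (H : Type)
    & CompleteNormedModule R[i] H := {
  hdot : {dot H for Num.conj} ;
  hdot_norm : forall x : H, hdot x x = `|x| ^+ 2 }.

#[short(type="hilbertType")]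
HB.structure Definition Hilbert (R : realType) :=
  {H of CompleteNormedModule_isHilbert R H & CompleteNormedModule R[i] H}.

Section Subspaces.
Variables (R : realType) (H : hilbertType R).
Implicit Types (A B M W : set H) (Hk : nat -> set H).

Definition closed_subspace M := GRing.submod_closed [in M] /\ closed M.

Definition closed_span A : set H := smallest closed_subspace A.

Definition orthogonal_sets A B := forall x y, A x -> B y -> hdot x y = 0.

(* The subset M is not required to contain A. *)
Definition ominus M A : set H :=
  [set x | M x /\ forall y, A y -> hdot x y = 0].

Definition has_dim W (d : nat) := exists e : 'I_d -> H,
  (forall c : 'I_d -> R[i], \sum_(j < d) c j *: e j = 0 -> forall j, c j = 0) /\
  W = [set \sum_(j < d) c j *: e j | c in [set: 'I_d -> R[i]]].

Definition finite_dim W := exists d, has_dim W d.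

Definition orthogonal_decomposition Hk :=
  [/\ forall k, closed_subspace (Hk k),
      forall j k, j != k -> orthogonal_sets (Hk j) (Hk k) &
      closed_span (\bigcup_k Hk k) = [set: H] ].

Definition algebraic_sum Hk : set H :=
  [set x | exists (m : nat) (h : nat -> H),
     (forall k, Hk k (h k)) /\ x = \sum_(k < m) h k].

Definition homogeneous Hk M := M = closed_span (\bigcup_k (M `&` Hk k)).

End Subspaces.

Section Tuples.
Variables (R : realType) (H : hilbertType R) (n : nat).
Implicit Types (T : 'I_n -> {linear H -> H}) (M W : set H) (Hk : nat -> set H).

Definition bounded_tuple T := forall i, bounded_near (T i) (nbhs (0 : H)).

Definition commuting T := forall i j x, T i (T j x) = T j (T i x).

Definition tpow T (k : 'I_n -> nat) : H -> H :=
  \big[comp/id]_(i < n) iter (k i) (T i).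

Definition tpoly T (p : mpoly.mpoly n R[i]) (x : H) : H :=
  \sum_(m <- mpoly.msupp p) mpoly.mcoeff m p *: tpow T (mpoly.fun_of_multinom m) x.

Definition invariant T M := forall i, T i @` M `<=` M.

Definition sum_images T M : set H :=
  [set \sum_(i < n) T i (m i) | m in [set m : 'I_n -> H | forall i, M (m i)]].

Definition wandering T W := closed_subspace W /\
  forall k : 'I_n -> nat, (exists i, k i != 0%N) ->
    orthogonal_sets W (tpow T k @` W).

Definition wandering_span T W : set H :=
  closed_span (\bigcup_(k in [set: 'I_n -> nat]) (tpow T k @` W)).

Definition wandering_part T M : set H := ominus M (sum_images T M).

Definition of_degree Hk (gamma : 'I_n -> nat) T :=
  forall k i, T i @` Hk k `<=` Hk (k + gamma i)%N.

Definition fg_topological T := exists (l : nat) (x : 'I_l -> H),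
  [set: H] =
    smallest (fun M => closed_subspace M /\ invariant T M) (range x).

Definition fg_codim T := finite_dim (wandering_part T [set: H]).

Definition fg_algebraic Hk T := exists (l : nat) (x : 'I_l -> H),
  (forall j, algebraic_sum Hk (x j)) /\
  algebraic_sum Hk =
    [set \sum_(j < l) tpoly T (p j) (x j) |
      p in [set: 'I_l -> mpoly.mpoly n R[i] ] ].

Definition fg_graded Hk gamma T := of_degree Hk gamma T /\
  [\/ fg_topological T, fg_codim T | fg_algebraic Hk T].

Definition homogeneous_wandering Hk T : set (set H) :=
  [set W | wandering T W /\ homogeneous Hk W].

Definition homogeneous_invariant Hk T : set (set H) :=
  [set M | [/\ closed_subspace M, invariant T M & homogeneous Hk M] ].

Definition generates T M (N : nat) := exists x : 'I_N -> H,
  (forall j, M (x j)) /\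
  closed_span [set tpoly T q.1 (x q.2) |
    q in [set: mpoly.mpoly n R[i] * 'I_N] ] = M.

(* N-cyclicity of T|M in B(M)^n, for a closed invariant subspace M of H: since
   p(T|M) x = p(T) x for x in M and M is closed, the closed linear span in M
   may be taken in H.  N = 0 is allowed, with the empty tuple, and occurs
   exactly for M = {0}: this is the only reading under which T|{0} is N-cyclic
   with N = dim (W_T {0}).  For M != {0} the N below is automatically >= 1 and
   the definition agrees with the one restricted to N >= 1. *)
Definition cyclic_on T M (N : nat) :=
  generates T M N /\ forall N', generates T M N' -> (N <= N')%N.

End Tuples.

(* Main.v *)
(* Only finite-dimensional orthogonal projections are needed.  A vector of
   W_T(M) orthogonal to a family generating the closed invariant subspace M is
   orthogonal to M, because T_i M is orthogonal to W_T(M); hence dim W_T(M) is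
   at most the size of any such family.  This gives finite codimension from
   each form of finite generation, and the minimality of N in (b).  Since
   gamma_i > 0, finite codimension implies by induction on k that H_k is finite
   dimensional and that
     M_k = sum_i T_i M_(k - gamma_i) + (W_T(M) meet H_k),   M_k = M meet H_k,
   for every homogeneous closed invariant M, hence [W_T(M)] = M.  For M = H the
   algebraic sum of the H_k is a finitely generated C[z]-module, so by Hilbert's
   basis theorem the algebraic sum of the M_k is finitely generated too, and
   W_T(M) is finite dimensional. *)
Require Import Defs.
From mathcomp Require Import all_boot all_order all_algebra.
From mathcomp Require Import all_classical all_reals all_analysis.
From mathcomp Require Import complex.

Set Implicit Arguments.
Unset Strict Implicit.
Unset Printing Implicit Defensive.

Import Order.TTheory GRing.Theory Num.Theory.
Import numFieldNormedType.Exports.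

Local Open Scope classical_set_scope.
Local Open Scope ring_scope.

(** * Linear subspaces and the Hilbert basis theorem *)

Section LinearSubspaces.
Variables (K : fieldType) (V : lmodType K).
Implicit Types (S : set V) (g : seq V).

Definition lin_subspace S :=
  S 0 /\ forall a x y, S x -> S y -> S (a *: x + y).

Lemma subspace0 S : lin_subspace S -> S 0.
Proof. by case. Qed.

Lemma subspaceD S x y : lin_subspace S -> S x -> S y -> S (x + y).
Proof. by move=> [_ SP] Sx Sy; rewrite -[x]scale1r; exact: SP. Qed.

Lemma subspaceZ S a x : lin_subspace S -> S x -> S (a *: x).
Proof. by move=> [S0 SP] Sx; rewrite -[_ *: _]addr0; exact: SP. Qed.

Lemma subspaceB S x y : lin_subspace S -> S x -> S y -> S (x - y).
Proof.
by move=> [_ SP] Sx Sy; rewrite addrC -scaleN1r; exact: SP.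
Qed.

Lemma subspace_sum S (I : Type) (r : seq I) (P : pred I) (F : I -> V) :
  lin_subspace S -> (forall i, P i -> S (F i)) -> S (\sum_(i <- r | P i) F i).
Proof.
move=> SS SF; elim/big_rec: _ => [|i x /SF Si Sx]; first exact: subspace0.
exact: subspaceD.
Qed.

Lemma subspaceI S S' :
  lin_subspace S -> lin_subspace S' -> lin_subspace (S `&` S').
Proof.
move=> [S0 SP] [S0' SP']; split=> [//|a x y [Sx Sx'] [Sy Sy']].
by split; [exact: SP|exact: SP'].
Qed.

Lemma subspace_preimage (f : {linear V -> V}) S :
  lin_subspace S -> lin_subspace (f @^-1` S).
Proof.
move=> [S0 SP]; split=> [|a x y Sx Sy] /=; first by rewrite linear0.
by rewrite linearP; exact: SP.
Qed.

Lemma subspace_smallest S : lin_subspace (smallest lin_subspace S).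
Proof.
split=> [U [[U0 _] _] //|a x y Sx Sy U [subU SU]].
by apply: subU.2; [exact: (Sx U (conj subU SU))|exact: (Sy U (conj subU SU))].
Qed.

End LinearSubspaces.

Arguments lin_subspace {K V} S.

(** * Hilbert's basis theorem for commuting operators *)

Section HilbertBasis.
Variables (K : fieldType) (V : lmodType K) (I : eqType).
Variable T : I -> {linear V -> V}.
Implicit Types (S N : set V) (ts : seq I) (g : seq V).

Definition stable_under ts S :=
  forall i, i \in ts -> forall x, S x -> S (T i x).

Definition submodule ts S := lin_subspace S /\ stable_under ts S.

(** Generation is tested against all submodules containing [g]. For a subspace [S] and [ts = [::]]
    this is finite dimensionality, and the later sections express it in this way. *)
Definition fin_generated ts S := exists2 g : seq V, {in g, forall x, S x} &
  forall S', submodule ts S' -> {in g, forall x, S' x} -> S `<=` S'.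

Definition noetherian ts N :=
  forall S, submodule ts S -> S `<=` N -> fin_generated ts S.

Lemma noetherian0 ts : noetherian ts [set 0].
Proof.
move=> S [S0 _] SN; exists [::] => // S' [S'0 _] _ x /SN ->.
exact: subspace0.
Qed.

(** The new space is [N] plus the line of [v]. Either [S] lies in [N], or some [s] in [S] has a
    nonzero coefficient at [v], and [s] together with generators of [S] meet [N] suffices. *)
Lemma noetherian_adjoin N v : lin_subspace N -> noetherian [::] N ->
  noetherian [::] [set x | exists c, N (x - c *: v)].
Proof.
move=> subN noeN S [subS _] SN.
have [g gSN gP] : fin_generated [::] (S `&` N).
  by apply: noeN; [split; [exact: subspaceI|]|move=> x []].
have [[s [c [Ss Nc c0]]]|noS] :=
  pselect (exists s c, [/\ S s, N (s - c *: v) & c != 0]); last first.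
  exists g => [x /gSN[]//|S' S'sub gS' x Sx]; apply: (gP S') => //; split=> //.
  have [c Nc] := SN _ Sx; have [c0|c0] := eqVneq c 0.
    by move: Nc; rewrite c0 scale0r subr0.
  by exfalso; apply: noS; exists x, c.
exists (s :: g) => [x|S' [subS' S'stab] gS' x Sx].
  by rewrite inE => /orP[/eqP->//|/gSN[]].
have [d Nd] := SN _ Sx.
(* The multiple [d / c] of [s] cancels the coefficient of [x] at [v]. *)
rewrite -[x](subrK ((d / c) *: s)); apply: subspaceD => //; last first.
  by apply: subspaceZ => //; apply: gS'; rewrite mem_head.
apply: (gP S') => // [y yg|]; first by apply: gS'; rewrite inE yg orbT.
split; first by apply: subspaceB => //; exact: subspaceZ.
have -> : x - (d / c) *: s = (x - d *: v) - (d / c) *: (s - c *: v).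
  by rewrite scalerBr scalerA divfK// opprB addrA subrK.
by apply: subspaceB => //; exact: subspaceZ.
Qed.

Lemma noetherian_span g :
  exists N, [/\ lin_subspace N, {in g, forall x, N x} & noetherian [::] N].
Proof.
elim: g => [|v g [N [subN gN noeN]]].
  exists [set 0]; split=> //; last exact: noetherian0.
  by split=> // a x y -> ->; rewrite scaler0 addr0.
exists [set x | exists c, N (x - c *: v)]; split.
- split=> [|a x y [c Nx] [d Ny]].
    by exists 0; rewrite scale0r subr0; exact: subspace0.
  exists (a * c + d); rewrite scalerDl -scalerA opprD addrACA -scalerBr.
  by exact: subN.2.
- move=> x; rewrite inE => /orP[/eqP->|/gN Nx].
    by exists 1; rewrite scale1r subrr; exact: subspace0.
  by exists 0; rewrite scale0r subr0.
- exact: noetherian_adjoin.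
Qed.

Lemma lift_seq (R : V -> V -> Prop) S g :
  {in g, forall a, exists2 s, S s & R a s} ->
  exists2 h : seq V, {in h, forall s, S s} &
    {in g, forall a, exists2 s, s \in h & R a s}.
Proof.
elim: g => [|a g IH] gP; first by exists [::].
have [|h hS hP] := IH; first by move=> b bg; apply: gP; rewrite inE bg orbT.
have [s Ss Ras] := gP a (mem_head _ _).
exists (s :: h) => [x|b]; rewrite inE => /orP[/eqP ->//|]; first exact: hS.
  by exists s; rewrite ?mem_head.
by move=> /hP[t th Rbt]; exists t; rewrite // inE th orbT.
Qed.

Section AdjoinOperator.
Variables (ts : seq I) (i : I) (N : set V).
Hypothesis T_comm : forall j, j \in ts -> forall x, T i (T j x) = T j (T i x).
Hypothesis subN : submodule ts N.

(* Polynomials in T i of degree < d with coefficients in N. *)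
Fixpoint polys d : set V := if d is e.+1 then
    [set x | exists a y, [/\ N a, polys e y & x = iter e (T i) a + y]]
  else [set 0].

(** Expansions in powers of [T i] need not be unique in [V], so every coefficient counts that occurs
    in degree [d] in some expansion of an element of [S]. *)
Definition leading S d : set V :=
  [set a | N a /\ exists2 y, polys d y & S (iter d (T i) a + y)].

Lemma iterP d a x y :
  iter d (T i) (a *: x + y) = a *: iter d (T i) x + iter d (T i) y.
Proof. by elim: d => //= d ->; rewrite linearP. Qed.

Lemma iter0 d : iter d (T i) 0 = 0.
Proof. by elim: d => //= d ->; rewrite linear0. Qed.

Lemma iter_comm d j x : j \in ts ->
  iter d (T i) (T j x) = T j (iter d (T i) x).
Proof. by move=> jts; elim: d => //= d ->; rewrite T_comm. Qed.

Lemma polys_submodule d : submodule ts (polys d).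
Proof.
elim: d => [|d [IHs IHt]]; split.
- by split=> // a x y -> ->; rewrite scaler0 addr0.
- by move=> j jts x ->; rewrite /= linear0.
- split=> [|c _ _ [a [x [Na Px ->]]] [b [y [Nb Py ->]]]].
    exists 0, 0; rewrite iter0 addr0.
    by split=> //; [exact: subspace0 subN.1|exact: subspace0].
  exists (c *: a + b), (c *: x + y); split; [exact: subN.1.2|exact: IHs.2|].
  by rewrite iterP scalerDr addrACA.
- move=> j jts _ [a [x [Na Px ->]]]; exists (T j a), (T j x).
  by rewrite linearD iter_comm//; split=> //; [exact: subN.2|exact: IHt].
Qed.

Lemma polysS d : polys d `<=` polys d.+1.
Proof.
move=> x Px; exists 0, x; rewrite iter0 add0r; split=> //.
exact: subspace0 subN.1.
Qed.

Lemma polys_shift d x : polys d x -> polys d.+1 (T i x).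
Proof.
elim: d x => [|d IH] x; first by move=> ->; rewrite linear0; exact: polysS.
move=> [a [y [Na Py ->]]]; exists a, (T i y).
by rewrite linearD; split=> //; exact: IH.
Qed.

Lemma polys_mono d e : (d <= e)%N -> polys d `<=` polys e.
Proof.
move=> /subnK <-; elim: (_ - _)%N => // k IH x /IH; exact: polysS.
Qed.

Lemma leading_submodule S d : submodule (i :: ts) S ->
  submodule ts (leading S d).
Proof.
move=> [subS stS]; have [subP stP] := polys_submodule d; split; first split.
- split; first exact: subspace0 subN.1.
  by exists 0; rewrite ?iter0 ?addr0; exact: subspace0.
- move=> c a b [Na [x Px Sx]] [Nb [y Py Sy]]; split; first exact: subN.1.2.
  exists (c *: x + y); first exact: subP.2.
  by rewrite iterP addrACA -scalerDr; exact: subS.2.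
- move=> j jts a [Na [x Px Sx]]; split; first exact: subN.2.
  exists (T j x); first exact: stP.
  by rewrite iter_comm// -linearD; apply: stS => //; rewrite inE jts orbT.
Qed.

(** Applying [T i] to an element of [S] shifts its expansion up by one degree and keeps the leading
    coefficient. *)
Lemma leading_mono S d e : submodule (i :: ts) S -> (d <= e)%N ->
  leading S d `<=` leading S e.
Proof.
move=> [subS stS] /subnK <-; elim: (_ - _)%N => // k IH a /IH[Na [y Py Sy]].
split=> //; exists (T i y); first exact: polys_shift.
by rewrite addSn iterS -linearD; apply: stS; rewrite ?mem_head.
Qed.

(** The leading modules increase with [d], so their union is a submodule of [N]; its finitely many
    generators all occur in one degree [D]. *)
Lemma leading_stationary S : noetherian ts N -> submodule (i :: ts) S ->
  exists D, forall d, leading S d `<=` leading S D.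
Proof.
move=> noeN subS; have subL d := leading_submodule d subS.
have [||g gL gP] := noeN [set a | exists d, leading S d a].
- split; first split.
  + by exists 0%N; exact: subspace0 (subL _).1.
  + move=> c a b [d La] [e Lb]; exists (maxn d e).
    by apply: (subL _).1.2; [apply: leading_mono La|apply: leading_mono Lb];
      rewrite ?leq_maxl ?leq_maxr.
  + by move=> j jts a [d La]; exists d; exact: (subL d).2.
- by move=> a [d []].
have [D gD] : exists D, {in g, forall a, leading S D a}.
  elim: g gL {gP} => [|a g IH] gL; first by exists 0%N.
  have [|D gD] := IH; first by move=> b bg; apply: gL; rewrite inE bg orbT.
  have [d ad] := gL a (mem_head _ _); exists (maxn d D) => b.
  rewrite inE => /orP[/eqP->|/gD Lb].
    by apply: leading_mono ad; rewrite ?leq_maxl.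
  by apply: leading_mono Lb; rewrite ?leq_maxr.
by exists D => d a La; apply: (gP (leading S D)) => //; exists d.
Qed.

(** Each generator of [leading S d] is the leading coefficient of some element of [S]. Such
    elements, collected for all [d <= D], form [G]. *)
Lemma leading_generators S D : noetherian ts N -> submodule (i :: ts) S ->
  exists2 G : seq V, {in G, forall x, S x} &
    forall S', submodule (i :: ts) S' -> {in G, forall x, S' x} ->
      forall d, (d <= D)%N -> leading S d `<=` leading S' d.
Proof.
move=> noeN subS.
have gen1 d : exists2 G : seq V, {in G, forall x, S x} &
    forall S', submodule (i :: ts) S' -> {in G, forall x, S' x} ->
      leading S d `<=` leading S' d.
  have [|g gL gP] := noeN _ (leading_submodule d subS); first by move=> x [].
  have [|h hS hP] := @lift_seq
    (fun a s => N a /\ exists2 y, polys d y & s = iter d (T i) a + y) S g.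
    move=> a /gL[Na [y Py Sy]]; exists (iter d (T i) a + y) => //.
    by split=> //; exists y.
  exists h => // S' subS' hS'; apply: gP; first exact: leading_submodule.
  move=> a /hP[s sh [Na [y Py sE]]]; split=> //; exists y => //.
  by rewrite -sE; exact: hS'.
elim: D => [|D [G GS GP]].
  have [G GS GP] := gen1 0%N; exists G => // S' sub' GS' d; rewrite leqn0.
  by move=> /eqP->; exact: GP.
have [G' GS' GP'] := gen1 D.+1; exists (G' ++ G) => [x|S' sub' GGS' d].
  by rewrite mem_cat => /orP[/GS'|/GS].
rewrite leq_eqVlt => /orP[/eqP->|].
  by apply: GP' => // x xG; apply: GGS'; rewrite mem_cat xG.
by rewrite ltnS; apply: GP => // x xG; apply: GGS'; rewrite mem_cat xG orbT.
Qed.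

(** Induction on the degree: subtracting an element of [S'] with the same leading coefficient lowers
    the degree of an element of [S]. *)
Lemma noetherian_polys : noetherian ts N ->
  noetherian (i :: ts) [set x | exists d, polys d x].
Proof.
move=> noeN S subS SN; have [D LD] := leading_stationary noeN subS.
have [G GS GP] := leading_generators D noeN subS; exists G => // S' subS' GS'.
suff SP d x : polys d x -> S x -> S' x.
  by move=> x Sx; have [d Px] := SN x Sx; exact: SP Px Sx.
(* The subtracted element is taken in [S] meet [S'], so that the difference stays in [S] and the
   induction applies to it. *)
have subSS' : submodule (i :: ts) (S `&` S').
  split; first exact: subspaceI subS.1 subS'.1.
  by move=> j jts y [Sy Sy']; split; [exact: subS.2|exact: subS'.2].
elim: d x => [|d IH] x; first by move=> -> _; exact: subspace0 subS'.1.
move=> [a [y [Na Py ->]]] Sx.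
have : leading (S `&` S') d a.
  (* Above degree [D] no new leading coefficients appear, and up to degree [D] the family [G]
     realises them in [S] meet [S']. *)
  have La : leading S (minn d D) a.
    have La : leading S d a by split=> //; exists y.
    by rewrite /minn; case: ifP => // _; exact: LD La.
  apply: leading_mono (geq_minl d D) _ _ => //; apply: GP La => //.
    by move=> z zG; split; [exact: GS|exact: GS'].
  exact: geq_minr.
move=> [_ [z Pz [Sz Sz']]].
rewrite -(subrK (iter d (T i) a + z) (iter d (T i) a + y)).
apply: subspaceD subS'.1 _ Sz'; apply: IH.
  rewrite opprD addrACA subrr add0r.
  exact: subspaceB (polys_submodule d).1 Py Pz.
exact: subspaceB subS.1 Sx Sz.
Qed.

End AdjoinOperator.

(** Operators on [V] take the place of a polynomial ring: each operator in [ts] acts as one more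
    variable, adjoined by passing from [N] to the polynomials in it with coefficients in [N]. *)
Theorem hilbert_basis ts g :
  (forall i j x, T i (T j x) = T j (T i x)) ->
  exists N, [/\ submodule ts N, {in g, forall x, N x} & noetherian ts N].
Proof.
move=> T_comm; elim: ts => [|i ts [N [subN gN noeN]]].
  by have [N [? ? ?]] := noetherian_span g; exists N; split.
have Ti_comm j : j \in ts -> forall x, T i (T j x) = T j (T i x) by [].
exists [set x | exists d, polys i N d x]; split.
- have subP d := polys_submodule Ti_comm subN d; split; first split.
  + by exists 0%N.
  + move=> c a b [d Pa] [e Pb]; exists (maxn d e).
    apply: (subP _).1.2.
      exact: (polys_mono subN (leq_maxl d e)).
    exact: (polys_mono subN (leq_maxr d e)).
  + move=> j; rewrite inE => /orP[/eqP->|jts] x [d Px].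
      by exists d.+1; exact: (polys_shift subN).
    by exists d; exact: (subP d).2.
- move=> x /gN Nx; exists 1%N, x, 0; split=> //.
  by rewrite /= addr0.
- exact: noetherian_polys.
Qed.

End HilbertBasis.

(** * Orthogonality in Hilbert spaces *)

Section InnerProduct.
Variables (R : realType) (H : hilbertType R).
Implicit Types (x y z : H) (A M S W : set H).

Lemma hdotC0 x y : hdot x y = 0 -> hdot y x = 0.
Proof. by move=> xy0; rewrite hermC /= xy0 conjC0 mulr0. Qed.

Lemma hdotPl (a : R[i]) x y z : hdot (a *: x + y) z = a * hdot x z + hdot y z.
Proof. exact: linearPl. Qed.

Lemma hdot0l z : hdot 0 z = 0.
Proof. exact: linear0l. Qed.

Lemma hdotDl x y z : hdot (x + y) z = hdot x z + hdot y z.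
Proof. exact: linearDl. Qed.

Lemma hdotBl x y z : hdot (x - y) z = hdot x z - hdot y z.
Proof. exact: linearBl. Qed.

Lemma hdotZl (a : R[i]) x z : hdot (a *: x) z = a * hdot x z.
Proof. exact: linearZl_LR. Qed.

Lemma hdotBr x y z : hdot z (x - y) = hdot z x - hdot z y.
Proof. exact: linearBr. Qed.

Lemma hdotZr (a : R[i]) x z : hdot z (a *: x) = a^*%C * hdot z x.
Proof. exact: linearZr_LR. Qed.

Lemma hdot_eq0 x : (hdot x x == 0) = (x == 0).
Proof. by rewrite hdot_norm expf_eq0 /= normr_eq0. Qed.

(** Pythagoras applied to [y] split into its projection on [x] and the remainder. This bound does
    the work of the Cauchy-Schwarz inequality. *)
Lemma norm_proj_le x y : `|(hdot y x / hdot x x) *: x| <= `|y|.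
Proof.
have [->|x0] := eqVneq x 0; first by rewrite scaler0 normr0.
set c := _ / _; have xx0 : hdot x x != 0 by rewrite hdot_eq0.
have ortho : hdot (y - c *: x) (c *: x) = 0.
  by rewrite hdotZr hdotBl hdotZl divfK// subrr mulr0.
rewrite -(@ler_pXn2r _ 2) ?nnegrE// -!hdot_norm -[y in leRHS](subrK (c *: x)).
by rewrite hnormDd// lerDr dnorm_ge0.
Qed.

(** If [z] is orthogonal to [x], then [y - z] and [y] have the same projection on [x], so [z] is no
    closer to [y] than the norm of that projection. *)
Lemma closed_perp x : closed [set y | hdot y x = 0].
Proof.
move=> y cly; apply: contrapT => yx0.
pose e := `|(hdot y x / hdot x x) *: x|.
have e0 : 0 < e.
  have x0 : x != 0.
    apply/eqP => x0; apply: yx0; rewrite /= x0; apply: hdotC0; exact: hdot0l.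
  rewrite normr_gt0 scaler_eq0 negb_or x0 andbT mulf_neq0 ?invr_eq0 ?hdot_eq0//.
  exact/eqP.
have [z [zx0]] := cly _ (nbhsx_ballx y e e0).
rewrite -ball_normE => yze; have := norm_proj_le x (y - z).
by rewrite hdotBl [hdot z x]zx0 subr0 -/e (lt_geF yze).
Qed.

Lemma closed_subspaceE M : closed_subspace M <-> lin_subspace M /\ closed M.
Proof.
split=> -[[M0 MP] clM]; split=> //.
  split=> [|a x y Mx My]; first by move: M0; rewrite inE.
  have := MP a x y; rewrite !inE; exact.
by split=> [|a x y]; rewrite !inE //; exact: MP.
Qed.

Lemma closed_subspace_subspace M : closed_subspace M -> lin_subspace M.
Proof. by move=> /closed_subspaceE[]. Qed.

Lemma closed_subspace_perp x : closed_subspace [set y | hdot y x = 0].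
Proof.
apply/closed_subspaceE; split; last exact: closed_perp.
split=> [|a y z /= yx0 zx0] /=; first by rewrite hdot0l.
by rewrite hdotPl yx0 zx0 mulr0 addr0.
Qed.

Lemma closed_subspace_bigI (J : Type) (D : set J) (F : J -> set H) :
  (forall j, D j -> closed_subspace (F j)) ->
  closed_subspace (\bigcap_(j in D) F j).
Proof.
move=> FP; apply/closed_subspaceE; split.
  split=> [j Dj|a x y Fx Fy j Dj];
    have [sF _] := (closed_subspaceE _).1 (FP j Dj).
    exact: subspace0.
  by apply: sF.2; [exact: Fx|exact: Fy].
by apply: closed_bigI => j /FP /closed_subspaceE[].
Qed.

Lemma closed_subspaceI M S :
  closed_subspace M -> closed_subspace S -> closed_subspace (M `&` S).
Proof.
move=> /closed_subspaceE[sM cM] /closed_subspaceE[sS cS].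
by apply/closed_subspaceE; split; [exact: subspaceI|exact: closedI].
Qed.

Lemma closed_subspace_preimage (f : {linear H -> H}) M :
  continuous f -> closed_subspace M -> closed_subspace (f @^-1` M).
Proof.
move=> cf /closed_subspaceE[sM cM]; apply/closed_subspaceE.
split; first exact: subspace_preimage.
by apply: preimage_closed => // x _; exact: cf.
Qed.

Lemma closed_subspace_setT : closed_subspace [set: H].
Proof. by apply/closed_subspaceE; split=> //; exact: closedT. Qed.

Lemma closed_subspace_span A : closed_subspace (closed_span A).
Proof. by apply: closed_subspace_bigI => M []. Qed.

Lemma closed_subspace_ominus M A :
  closed_subspace M -> closed_subspace (ominus M A).
Proof.
move=> cM; have -> : ominus M A = M `&` \bigcap_(y in A) [set x | hdot x y = 0].
  by apply/seteqP; split=> x [].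
apply: closed_subspaceI => //; apply: closed_subspace_bigI => y _.
exact: closed_subspace_perp.
Qed.

(** * Finite-dimensional projections and dimension bounds *)

Lemma perp_self x M : M x -> (forall y, M y -> hdot y x = 0) -> x = 0.
Proof. by move=> Mx /(_ x Mx)/eqP; rewrite hdot_eq0 => /eqP. Qed.

(** Gram-Schmidt by induction on [g]: the new vector [v] is first made orthogonal to the span of the
    others. *)
Lemma span_projection (g : seq H) x :
  exists2 p, smallest lin_subspace [set` g] p &
    forall y, smallest lin_subspace [set` g] y -> hdot y (x - p) = 0.
Proof.
suff [p gp pP] : exists2 p, smallest lin_subspace [set` g] p &
    {in g, forall y, hdot y (x - p) = 0}.
  exists p => // y gy; apply: (gy [set y | hdot y (x - p) = 0]).
  by split=> //; exact/closed_subspace_subspace/closed_subspace_perp.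
elim: g x => [|v g IH] x.
  by exists 0 => //; exact: subspace0 (subspace_smallest _).
pose G := smallest lin_subspace [set` v :: g].
have sG : lin_subspace G by exact: subspace_smallest.
have gG : smallest lin_subspace [set` g] `<=` G.
  apply: smallest_sub => // y gy; apply: sub_gen_smallest.
  by rewrite /= inE gy orbT.
have Gv : G v by apply: sub_gen_smallest; rewrite /= mem_head.
have [p gp pP] := IH x; have [q gq qP] := IH v.
have ginP z : {in g, forall y, hdot y z = 0} ->
    forall y, smallest lin_subspace [set` g] y -> hdot y z = 0.
  move=> zP y gy; apply: (gy [set y | hdot y z = 0]).
  by split=> //; exact/closed_subspace_subspace/closed_subspace_perp.
(* If [v - q] vanishes, [v] is already in the span of [g] and [p] serves again. Otherwise [v - q] is
   a new orthogonal direction, and [p] gains the component of [x - p] along it. *)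
have [vq|vq] := eqVneq (v - q) 0.
  exists p; first exact: gG.
  move=> y; rewrite inE => /orP[/eqP->|/pP//].
  by apply: ginP => //; rewrite -[v](subrK q) vq add0r.
set w := v - q in vq qP *; pose c := hdot (x - p) w / hdot w w.
have pcw : {in g, forall y, hdot y (x - (p + c *: w)) = 0}.
  by move=> y yg; rewrite opprD addrA hdotBr pP// hdotZr qP// mulr0 subrr.
exists (p + c *: w).
  apply: (subspaceD sG); first exact: gG.
  by apply: (subspaceZ _ sG); apply: (subspaceB sG) => //; exact: gG.
move=> y; rewrite inE => /orP[/eqP->|/pcw//].
rewrite -[v](subrK q) hdotDl [X in _ + X]ginP// addr0; apply: hdotC0.
rewrite opprD addrA hdotBl hdotZl /c divfK ?subrr//.
by rewrite hdot_eq0.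
Qed.

(** The kernel in [W] of the functional given by [x ord0] has codimension at most one and is
    separated by the remaining functionals. *)
Lemma has_dim_separated r (x : 'I_r -> H) W : lin_subspace W ->
  (forall y, W y -> (forall j, hdot y (x j) = 0) -> y = 0) ->
  exists2 d, (d <= r)%N & has_dim W d.
Proof.
elim: r x W => [|r IH] x W subW sep.
  exists 0%N => //; exists (fun=> 0); split=> [c _ []//|].
  apply/seteqP; split=> [y Wy|_ [c _ <-]]; last first.
    by rewrite big_ord0; exact: subspace0.
  by exists (fun=> 0) => //; rewrite big_ord0 (sep y)// => -[].
pose W' := W `&` [set y | hdot y (x ord0) = 0].
have [||d dr [e [e_free eW]]] := IH (fun j => x (lift ord0 j)) W'.
- apply: subspaceI => //.
  exact/closed_subspace_subspace/closed_subspace_perp.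
- move=> y [Wy yx0] ysep; apply: sep => // j.
  by case: (unliftP ord0 j) => [k|] ->.
have [WW'|/existsNP[w /not_implyP[Ww ww]]] := pselect (W `<=` W').
  exists d; first exact: leqW.
  by exists e; split=> //; rewrite -eW; apply/seteqP; split=> // y [].
have wx0 : hdot w (x ord0) != 0 by apply/eqP => wx0; apply: ww.
pose e' (j : 'I_d.+1) := if unlift ord0 j is Some k then e k else w.
have sumE (c : 'I_d.+1 -> R[i]) : \sum_j c j *: e' j =
    c ord0 *: w + \sum_j c (lift ord0 j) *: e j.
  rewrite big_ord_recl /e' unlift_none; congr (_ + _).
  by apply: eq_bigr => j _; rewrite liftK.
have W'e c : W' (\sum_j c j *: e j) by rewrite eW; exists c.
exists d.+1 => //; exists e'; split=> [c|].
  rewrite sumE => ce0.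
  have c0 : c ord0 = 0.
    have /eqP : hdot (c ord0 *: w + \sum_j c (lift ord0 j) *: e j) (x ord0) = 0.
      by rewrite ce0 hdot0l.
    rewrite hdotDl hdotZl [X in _ + X](W'e _).2 addr0.
    by rewrite mulf_eq0 (negPf wx0) orbF => /eqP.
  move: ce0; rewrite c0 scale0r add0r => /e_free c'0 j.
  by case: (unliftP ord0 j) => [k|] ->.
apply/seteqP; split=> [y Wy|_ [c _ <-]]; last first.
  rewrite sumE; apply: subspaceD => //; first exact: subspaceZ.
  by case: (W'e (fun j => c (lift ord0 j))).
pose a := hdot y (x ord0) / hdot w (x ord0).
have : W' (y - a *: w).
  split; first by apply: subspaceB => //; exact: subspaceZ.
  by rewrite /= hdotBl hdotZl /a divfK// subrr.
rewrite eW => -[c _ cE].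
exists (fun j => if unlift ord0 j is Some k then c k else a) => //.
rewrite sumE unlift_none; under eq_bigr do rewrite liftK.
by rewrite cE addrC subrK.
Qed.

End InnerProduct.

(** * Graded tuples and wandering subspaces *)

Section FiniteDimension.
Variables (K : fieldType) (V : lmodType K) (I : eqType).
Variable T : I -> {linear V -> V}.

(** The vectors of [g] may lie outside [S]; a noetherian space containing them yields generators
    inside [S]. *)
Lemma fin_generated_le (S : set V) (g : seq V) : lin_subspace S ->
  (forall N, lin_subspace N -> {in g, forall x, N x} -> S `<=` N) ->
  fin_generated T [::] S.
Proof.
move=> sS Sg; have [N [sN gN noeN]] := noetherian_span T g.
by apply: noeN => //; exact: Sg.
Qed.

Lemma fin_generatedS (S S' : set V) : lin_subspace S -> S `<=` S' ->
  fin_generated T [::] S' -> fin_generated T [::] S.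
Proof.
move=> sS SS' [g gS' gP]; apply: (fin_generated_le (g := g)) => // N sN gN.
by apply: (subset_trans SS'); apply: gP.
Qed.

End FiniteDimension.

(** * Invariant subspaces and the wandering part *)

Section Tuples.
Variables (R : realType) (H : hilbertType R) (n : nat).
Variable T : 'I_n -> {linear H -> H}.
Implicit Types (M S W : set H) (x y : H).

Lemma lin_comb_basis d (e : 'I_d -> H) j :
  [set \sum_(i < d) c i *: e i | c in [set: 'I_d -> R[i]]] (e j).
Proof.
exists (fun i => (i == j)%:R) => //.
rewrite (bigD1 j)//= eqxx scale1r big1 ?addr0// => i /negPf ->.
by rewrite scale0r.
Qed.

Lemma has_dim_fin_generated W d : has_dim W d -> fin_generated T [::] W.
Proof.
move=> [e [_ ->]]; exists [seq e j | j <- enum 'I_d].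
  by move=> _ /mapP[j _ ->]; exact: lin_comb_basis.
move=> S [sS _] eS _ [c _ <-]; apply: subspace_sum => // j _.
by apply: subspaceZ => //; apply: eS; apply: map_f; rewrite mem_enum.
Qed.

Lemma fin_generated_projection S x : lin_subspace S ->
  fin_generated T [::] S ->
  exists2 p, S p & forall y, S y -> hdot y (x - p) = 0.
Proof.
move=> sS [g gS gP]; have [p gp pP] := span_projection g x; exists p.
  exact: gp.
move=> y Sy; apply: pP => U [sU gU]; exact: (gP U).
Qed.

Lemma invariantP M : Defs.invariant T M <-> forall i x, M x -> M (T i x).
Proof.
split=> [inv i x Mx|inv i _ [x Mx <-]]; last exact: inv.
by apply: (inv i); exists x.
Qed.

Lemma invariant_stable M : Defs.invariant T M <-> stable_under T (enum 'I_n) M.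
Proof.
rewrite invariantP; split=> [inv i _ x|inv i x]; first exact: inv.
by apply: inv; rewrite mem_enum.
Qed.

Lemma tpow_ind (P : (H -> H) -> Prop) k :
  P id -> (forall i f, P f -> P (T i \o f)) -> P (tpow T k).
Proof.
move=> P1 PT; rewrite /tpow; elim/big_rec: _ => // i f _ Pf.
by elim: (k i) => //= m IH; exact: PT IH.
Qed.

Lemma tpow0 x : tpow T (fun=> 0%N) x = x.
Proof.
suff -> : tpow T (fun=> 0%N) = id by [].
by rewrite /tpow; elim/big_rec: _ => // i f _ ->.
Qed.

Lemma tpow_invariant M k x : Defs.invariant T M -> M x -> M (tpow T k x).
Proof.
move=> /invariantP inv Mx.
by apply: (tpow_ind (P := fun f => M (f x))) => // i f; exact: inv.
Qed.

Lemma sum_imagesT M i x : M 0 -> M x -> sum_images T M (T i x).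
Proof.
move=> M0 Mx; exists (fun j => if j == i then x else 0).
  by move=> j /=; case: ifP.
by rewrite (bigD1 i)//= eqxx big1 ?addr0// => j /negPf ->; rewrite linear0.
Qed.

(** As [0] lies in [M], each [T i y] is itself a sum of images, so orthogonality may be tested on
    single images. *)
Lemma wandering_partP M x : M 0 ->
  wandering_part T M x <-> M x /\ forall i y, M y -> hdot (T i y) x = 0.
Proof.
move=> M0; split=> -[Mx xP]; split=> //.
  by move=> i y My; apply: hdotC0; apply: xP; exact: sum_imagesT.
move=> _ [m mM <-]; apply: hdotC0.
have sx := closed_subspace_subspace (closed_subspace_perp x).
by apply: (subspace_sum _ sx) => i _; exact: xP (mM i).
Qed.

Lemma wandering_part_sub M : wandering_part T M `<=` M.
Proof. by move=> x []. Qed.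

Lemma tpoly_invariant M p x : lin_subspace M -> Defs.invariant T M -> M x ->
  M (tpoly T p x).
Proof.
move=> sM inv Mx; apply: subspace_sum => // m _.
by apply: subspaceZ => //; exact: tpow_invariant.
Qed.

Lemma tpolyX k x :
  tpoly T (mpoly.mpolyX R[i] (mpoly.Multinom [tuple k i | i < n])) x =
  tpow T k x.
Proof.
rewrite /tpoly mpoly.msuppX big_seq1 mpoly.mcoeffX eqxx scale1r.
by congr (tpow T _ x); apply/funext => i; rewrite mpoly.mnmE.
Qed.

Lemma wandering_part_dim M r (x : 'I_r -> H) :
  closed_subspace M -> Defs.invariant T M -> (forall j, M (x j)) ->
  (forall S, closed_subspace S -> Defs.invariant T S -> (forall j, S (x j)) ->
     M `<=` S) ->
  exists2 d, (d <= r)%N & has_dim (wandering_part T M) d.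
Proof.
move=> cM invM Mx genM; have sM := closed_subspace_subspace cM.
have M0 := subspace0 sM.
have sW := closed_subspace_subspace
  (closed_subspace_ominus (sum_images T M) cM).
apply: (has_dim_separated (x := x) sW) => w /(wandering_partP _ M0)[Mw wP] wx.
(* This intersection is invariant because [w] is orthogonal to every [T i y] with [y] in [M]. *)
have MS : M `<=` M `&` [set y | hdot y w = 0].
  apply: genM.
  - by apply: closed_subspaceI => //; exact: closed_subspace_perp.
  - apply/invariantP => i y [My _]; split; last exact: wP.
    exact: (invariantP M).1.
  - by move=> j; split=> //; apply: hdotC0.
by apply: (perp_self Mw) => y /MS[].
Qed.

Lemma generatesP M N : closed_subspace M -> Defs.invariant T M ->
  generates T M N ->
  exists2 d, (d <= N)%N & has_dim (wandering_part T M) d.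
Proof.
move=> cM invM [x [Mx xM]].
apply: (wandering_part_dim cM invM Mx) => S cS invS Sx.
rewrite -xM; apply: smallest_sub => // _ [[p j] _ <-].
by apply: tpoly_invariant => //; exact: closed_subspace_subspace.
Qed.

Hypothesis T_bounded : bounded_tuple T.

Lemma closed_subspace_T i S : closed_subspace S ->
  closed_subspace (T i @^-1` S).
Proof.
apply: closed_subspace_preimage.
exact: bounded_linear_continuous (T_bounded i).
Qed.

Lemma closed_subspace_tpow k S : closed_subspace S ->
  closed_subspace (tpow T k @^-1` S).
Proof.
apply: (tpow_ind (P := fun f : H -> H => forall S, closed_subspace S ->
  closed_subspace (f @^-1` S))) => // i f Pf U cU.
exact/(Pf (T i @^-1` U))/closed_subspace_T.
Qed.

Hypothesis T_comm : commuting T.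

(** Commutativity moves [T i] inwards to the factor of index [i], which occurs exactly once because
    the index list is duplicate-free. *)
Lemma tpowS i k x :
  T i (tpow T k x) = tpow T (fun j => (k j + (j == i))%N) x.
Proof.
have iterC j m y : T i (iter m (T j) y) = iter m (T j) (T i y).
  by elim: m => //= m IH; rewrite T_comm IH.
rewrite /tpow; have := mem_index_enum i; have := index_enum_uniq 'I_n.
elim: (index_enum 'I_n) => //= j r IH /andP[jr ur].
rewrite inE !big_cons /= => /orP[/eqP ij|ir]; last first.
  have /negPf -> : j != i by apply: contra jr => /eqP->.
  by rewrite addn0 iterC IH.
rewrite -ij eqxx addn1 /= ij; congr (T j (iter _ _ _)).
rewrite [in LHS]big_seq [in RHS]big_seq.
under [in RHS]eq_bigr => l lr.
  have /negPf -> : l != j by apply: contraNneq jr => <-.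
  rewrite addn0; over.
by [].
Qed.

Lemma tpow_split k i x : k i != 0%N ->
  tpow T k x = T i (tpow T (fun j => (k j - (j == i))%N) x).
Proof.
move=> ki; rewrite tpowS; congr (tpow T _ x); apply/funext => j.
by case: eqVneq => [->|]; rewrite ?subn1 ?addn1 ?prednK ?lt0n// subn0 addn0.
Qed.

Lemma closed_subspace_wandering_span W :
  closed_subspace (wandering_span T W).
Proof. exact: closed_subspace_span. Qed.

Lemma invariant_wandering_span W : Defs.invariant T (wandering_span T W).
Proof.
have cW := closed_subspace_wandering_span W.
apply/invariantP => i; apply: smallest_sub; first exact: closed_subspace_T.
move=> _ [k _ [w Ww <-]] /=; rewrite tpowS; apply: sub_gen_smallest.
by exists (fun j => (k j + (j == i))%N) => //; exists w.
Qed.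

Lemma sub_wandering_span W : W `<=` wandering_span T W.
Proof.
move=> w Ww; apply: sub_gen_smallest; exists (fun=> 0%N) => //.
by exists w; rewrite ?tpow0.
Qed.

Lemma wandering_span_sub W M : closed_subspace M -> Defs.invariant T M ->
  W `<=` M -> wandering_span T W `<=` M.
Proof.
move=> cM invM WM; apply: smallest_sub => // _ [k _ [w /WM Mw <-]].
exact: tpow_invariant.
Qed.

(** * Recovering a wandering subspace from its span *)

Section Wandering.
Variable W : set H.
Hypothesis wW : wandering T W.

(** Applying [T i] to T^k W raises an exponent, which makes it nonzero, so the image is orthogonal
    to [W]. Continuity extends this to the closed span. *)
Lemma wandering_sub_part : W `<=` wandering_part T (wandering_span T W).
Proof.
have c0 := closed_subspace_wandering_span W.
move=> w Ww; apply/wandering_partP.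
  exact: subspace0 (closed_subspace_subspace c0).
split; first exact: sub_wandering_span.
move=> i; apply: (smallest_sub (X := T i @^-1` [set z | hdot z w = 0])).
  by apply: closed_subspace_T; exact: closed_subspace_perp.
move=> _ [k _ [v Wv <-]] /=; apply: hdotC0.
apply: (wW.2 (fun j => (k j + (j == i))%N) _ w) => //.
  by exists i; rewrite eqxx addn1.
by exists v => //; rewrite tpowS.
Qed.

(** Finite dimension allows projecting [x] onto [W]. The remainder is orthogonal to T^k W, for k = 0
    by projection and for other k because it lies in the wandering part. It is thus orthogonal to
    the span containing it. *)
Lemma wandering_part_span : fin_generated T [::] W ->
  wandering_part T (wandering_span T W) = W.
Proof.
have c0 := closed_subspace_wandering_span W.
move=> fW; apply/seteqP; split; last exact: wandering_sub_part.
have sub0 := closed_subspace_subspace c0.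
move=> x Wx; have [p Wp pP] := fin_generated_projection x
  (closed_subspace_subspace wW.1) fW.
have sWp := closed_subspace_subspace (closed_subspace_ominus
  (sum_images T (wandering_span T W)) c0).
have Wz : wandering_part T (wandering_span T W) (x - p).
  by apply: subspaceB => //; exact: wandering_sub_part.
rewrite -[x](subrK p) (perp_self (wandering_part_sub Wz)) ?add0r//.
apply: (smallest_sub (X := [set y | hdot y (x - p) = 0])) =>
  [|_ [k _ [w Ww <-]] /=]; first exact: closed_subspace_perp.
have [[i ki]|k0] := pselect (exists i, k i != 0%N).
  rewrite (tpow_split _ ki).
  apply: ((wandering_partP _ (subspace0 sub0)).1 Wz).2.
  apply: (tpow_invariant (M := wandering_span T W)).
    exact: invariant_wandering_span.
  exact: sub_wandering_span.
have -> : k = fun=> 0%N.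
  by apply/funext => i; apply/eqP; apply: contra_notT k0 => ki; exists i.
by rewrite tpow0; exact: pP.
Qed.

End Wandering.

Lemma wandering_wandering_part M : closed_subspace M -> Defs.invariant T M ->
  wandering T (wandering_part T M).
Proof.
move=> cM invM; have M0 := subspace0 (closed_subspace_subspace cM).
split; first exact: closed_subspace_ominus.
move=> k [i ki] x _ Wx [y Wy <-]; apply: hdotC0; rewrite (tpow_split _ ki).
apply: ((wandering_partP _ M0).1 Wx).2; apply: tpow_invariant => //.
exact: wandering_part_sub Wy.
Qed.

(** * Graded tuples and homogeneous subspaces *)

Section Graded.
Variables (Hk : nat -> set H) (gamma : 'I_n -> nat).
Hypothesis Hk_decomp : orthogonal_decomposition Hk.
Hypothesis gamma_gt0 : forall i, (0 < gamma i)%N.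
Hypothesis T_degree : of_degree Hk gamma T.

Lemma closed_subspace_Hk k : closed_subspace (Hk k).
Proof. by case: Hk_decomp. Qed.

Lemma lin_subspace_Hk k : lin_subspace (Hk k).
Proof. exact/closed_subspace_subspace/closed_subspace_Hk. Qed.

Lemma T_degreeP i k x : Hk k x -> Hk (k + gamma i)%N (T i x).
Proof. by move=> kx; apply: T_degree; exists x. Qed.

Lemma tpow_degree k j : exists m, forall x, Hk j x -> Hk m (tpow T k x).
Proof.
apply: (tpow_ind (P := fun f => exists m, forall x, Hk j x -> Hk m (f x))).
  by exists j.
by move=> i f [m fm]; exists (m + gamma i)%N => x /fm /T_degreeP; exact.
Qed.

Lemma homogeneous_ind M S : homogeneous Hk M -> closed_subspace S ->
  (forall k x, M x -> Hk k x -> S x) -> M `<=` S.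
Proof.
move=> hM cS MS; rewrite hM; apply: smallest_sub => // x [k _ [Mx kx]].
exact: (MS k).
Qed.

Lemma homogeneousP M : closed_subspace M ->
  M `<=` closed_span (\bigcup_k (M `&` Hk k)) -> homogeneous Hk M.
Proof.
move=> cM MM; apply/seteqP; split=> //.
by apply: smallest_sub => // x [k _ []].
Qed.

Lemma homogeneousT : homogeneous Hk [set: H].
Proof.
case: Hk_decomp => _ _ HkT; rewrite /homogeneous -[LHS]HkT.
by congr closed_span; apply: eq_bigcupr => k _; rewrite setTI.
Qed.

Lemma homogeneous_wandering_span W : homogeneous Hk W ->
  homogeneous Hk (wandering_span T W).
Proof.
move=> hW; apply: homogeneousP; first exact: closed_subspace_span.
apply: smallest_sub; first exact: closed_subspace_span.
move=> _ [k _ [w Ww <-]]; move: w Ww; apply: (homogeneous_ind hW).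
  by apply: closed_subspace_tpow; exact: closed_subspace_span.
move=> j x Wx jx /=; have [m /(_ _ jx) mx] := tpow_degree k j.
apply: sub_gen_smallest; exists m => //; split=> //.
apply: (tpow_invariant (M := wandering_span T W)).
  exact: invariant_wandering_span.
exact: sub_wandering_span.
Qed.

Section HomogeneousInvariant.
Variable M : set H.
Hypotheses (cM : closed_subspace M) (invM : Defs.invariant T M).
Hypothesis hM : homogeneous Hk M.

Let sM : lin_subspace M := closed_subspace_subspace cM.

(** For the other pairs of [i] and [j], the vector [T i y] lies in a component orthogonal to
    [Hk k]. *)
Lemma wandering_part_degree k u : M u -> Hk k u ->
  (forall i j y, (j + gamma i = k)%N -> M y -> Hk j y -> hdot (T i y) u = 0) ->
  wandering_part T M u.
Proof.
move=> Mu ku uP; apply/wandering_partP; first exact: subspace0.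
split=> // i.
apply: (homogeneous_ind hM (S := T i @^-1` [set z | hdot z u = 0])).
  by apply: closed_subspace_T; exact: closed_subspace_perp.
move=> j y My jy /=; have [|jk] := eqVneq (j + gamma i)%N k.
  by move/uP; apply.
by case: Hk_decomp => _ /(_ _ _ jk) + _; apply=> //; exact: T_degreeP.
Qed.

(** [G] consists of images of generators of the lower parts of [M], and [u] is what remains of [x]
    after projection onto its span. Finiteness is assumed only below [k], so that the lemma can
    serve in the induction proving each [Hk k] finite dimensional. *)
Lemma wandering_decomposition k :
  (forall j, (j < k)%N -> fin_generated T [::] (M `&` Hk j)) ->
  exists2 G : seq H,
    {in G, forall z, exists i j y,
      [/\ (j + gamma i = k)%N, M y, Hk j y & z = T i y]} &
    forall x, M x -> Hk k x -> exists u,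
      [/\ wandering_part T M u, Hk k u &
          smallest lin_subspace [set` G] (x - u)].
Proof.
move=> fin_lt.
(* For [j >= k] the empty list is a dummy value. *)
have /choice[g gP] j : exists g : seq H, (j < k)%N ->
    {in g, forall y, (M `&` Hk j) y} /\
    (forall S, lin_subspace S -> {in g, forall y, S y} -> M `&` Hk j `<=` S).
  have [jk|] := ltnP j k; last by exists [::].
  have [g gM gS] := fin_lt j jk; exists g => _; split=> // S sS gS'.
  by apply: gS => //.
(* The filter discards the indices for which [k - gamma i] would be truncated. *)
pose G := [seq T i y | i <- [seq i <- enum 'I_n | gamma i <= k]%N,
                       y <- g (k - gamma i)%N].
have GP : {in G, forall z, exists i j y,
    [/\ (j + gamma i = k)%N, M y, Hk j y & z = T i y]}.
  move=> z /allpairsPdep[i [y [+ yg ->]]].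
  rewrite mem_filter => /andP[ik _]; exists i, (k - gamma i)%N, y.
  have [|/(_ _ yg)[]] := gP (k - gamma i)%N; last by rewrite subnK.
  by rewrite -subn_gt0 subKn.
have sMk : lin_subspace (M `&` Hk k).
  by apply: subspaceI => //; exact: lin_subspace_Hk.
exists G => // x Mx kx; have [p Gp pP] := span_projection G x.
have [Mp kp] : (M `&` Hk k) p.
  apply: Gp; split=> // z /GP[i [j [y [<- My jy ->]]]]; split.
    exact: (invariantP M).1.
  exact: T_degreeP.
have [Mu ku] : (M `&` Hk k) (x - p) by apply: subspaceB.
exists (x - p); split=> //; last by rewrite opprB addrC subrK.
apply: (wandering_part_degree Mu ku) => i j y jk My jy.
have jltk : (j < k)%N by rewrite -jk -addn1 leq_add2l.
have [gM gS] := gP j jltk.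
apply: (gS (T i @^-1` [set z | hdot z (x - p) = 0])) => //.
  exact/subspace_preimage/closed_subspace_subspace/closed_subspace_perp.
move=> z zg /=; apply: pP; apply: sub_gen_smallest => /=; apply/allpairsPdep.
exists i, z; split=> //; last by rewrite -jk addnK.
by rewrite mem_filter mem_enum -jk leq_addl.
Qed.

End HomogeneousInvariant.

(** * Consequences of finite codimension *)

Section FiniteCodimension.
Variable d : nat.
Hypothesis dim_WH : has_dim (wandering_part T [set: H]) d.

Let cT : closed_subspace [set: H] := closed_subspace_setT H.
Let invT : Defs.invariant T [set: H]. Proof. by move=> i x. Qed.

Lemma fin_generated_Hk k : fin_generated T [::] (Hk k).
Proof.
elim/ltn_ind: k => k IH.
have [|G _ GP] := @wandering_decomposition _ cT invT homogeneousT k.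
  by move=> j jk; rewrite setTI; exact: IH.
have [e eW We] := has_dim_fin_generated dim_WH.
apply: (fin_generated_le (S := Hk k) T (g := G ++ e)).
  exact: lin_subspace_Hk.
move=> N sN GeN x kx; have [u [Wu ku xu]] := GP x I kx.
rewrite -[x](subrK u); apply: subspaceD => //.
  by apply: xu; split=> // z zG; apply: GeN; rewrite mem_cat zG.
by apply: We Wu => // z ze; apply: GeN; rewrite mem_cat ze orbT.
Qed.

Lemma fin_generated_homogeneous_part M k : closed_subspace M ->
  fin_generated T [::] (M `&` Hk k).
Proof.
move=> /closed_subspace_subspace sM.
apply: fin_generatedS (fin_generated_Hk k); last by move=> x [].
by apply: subspaceI => //; exact: lin_subspace_Hk.
Qed.

(** [S] is only a linear subspace, so that both closed spans and the algebraic module of the basis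
    theorem can be substituted for it. *)
Lemma homogeneous_part_sub M S k : closed_subspace M -> Defs.invariant T M ->
  homogeneous Hk M -> lin_subspace S -> Defs.invariant T S ->
  wandering_part T M `<=` S -> M `&` Hk k `<=` S.
Proof.
move=> cM invM hM sS invS WS; elim/ltn_ind: k => k IH x [Mx kx].
have [|G GM GP] := wandering_decomposition cM invM hM (k := k).
  by move=> j _; exact: fin_generated_homogeneous_part.
have [u [/WS Su ku xu]] := GP x Mx kx.
rewrite -[x](subrK u); apply: subspaceD => //.
apply: xu; split=> // z /GM[i [j [y [jk My jy ->]]]].
apply: (invariantP S).1 => //; apply: (IH j) => //.
by rewrite -jk -addn1 leq_add2l.
Qed.

Lemma wandering_part_finite M : closed_subspace M -> Defs.invariant T M ->
  homogeneous Hk M -> exists d, has_dim (wandering_part T M) d.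
Proof.
move=> cM invM hM; have [e eW We] := has_dim_fin_generated dim_WH.
have [N [[sN stN] eN noeN]] := hilbert_basis (enum 'I_n) e T_comm.
(* [N] contains a spanning family of the wandering part of [H], so the case M = H places every
   component in [N]. *)
have HkN k : Hk k `<=` N.
  rewrite -[Hk k]setTI; apply: homogeneous_part_sub => //.
  - exact: homogeneousT.
  - exact/invariant_stable.
  - exact: We.
(* The algebraic sum of the homogeneous parts of [M] is a submodule of [N]. Its finitely many
   generators also generate [M] as a closed invariant subspace. *)
pose M0 := smallest lin_subspace (\bigcup_k (M `&` Hk k)).
have sM0 : lin_subspace M0 by exact: subspace_smallest.
have M0M : M0 `<=` M.
  by apply: smallest_sub; [exact: closed_subspace_subspace|move=> x [k _ []]].
have invM0 : Defs.invariant T M0.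
  apply/invariantP => i; apply: smallest_sub; first exact: subspace_preimage.
  move=> x [k _ [Mx kx]]; apply: sub_gen_smallest; exists (k + gamma i)%N => //.
  by split; [exact: (invariantP M).1|exact: T_degreeP].
have [||g gM0 gP] := noeN M0.
- by split=> //; exact/invariant_stable.
- by apply: smallest_sub => // x [k _ [_ /HkN]].
have [||||m _ ?] :=
  @wandering_part_dim M (size g) (fun j => g`_j); last by exists m.
- exact: cM.
- exact: invM.
- by move=> j; apply: M0M; apply: gM0; rewrite mem_nth.
move=> S cS invS gS; apply: (homogeneous_ind hM) => // k x Mx kx.
apply: (gP S); last by apply: sub_gen_smallest; exists k.
  by split; [exact: closed_subspace_subspace|exact/invariant_stable].
by move=> y /(nthP 0)[j jg <-]; exact: (gS (Ordinal jg)).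
Qed.

(** Let z be the remainder of [x] after projection onto the span of the homogeneous parts of [W]. A
    homogeneous vector of [M] is the sum of a homogeneous vector of [W], orthogonal to z by
    projection, and of images under the [T i], orthogonal to z because z lies in [W]. So z is
    orthogonal to [M] and vanishes. *)
Lemma homogeneous_wandering_part M : closed_subspace M -> Defs.invariant T M ->
  homogeneous Hk M -> homogeneous Hk (wandering_part T M).
Proof.
move=> cM invM hM; set W := wandering_part T M.
have cW : closed_subspace W by exact: closed_subspace_ominus.
apply: homogeneousP => // x Wx.
have cW' := closed_subspace_span (\bigcup_k (W `&` Hk k)).
set W' := closed_span _ in cW' *.
have W'W : W' `<=` W by apply: smallest_sub => // y [k _ []].
have fW' : fin_generated T [::] W'.
  have [m Wm] := wandering_part_finite cM invM hM.
  apply: fin_generatedS W'W (has_dim_fin_generated Wm).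
  exact: closed_subspace_subspace.
have [p W'p pP] :=
  fin_generated_projection x (closed_subspace_subspace cW') fW'.
have Wz : W (x - p).
  by apply: subspaceB => //; [exact: closed_subspace_subspace|exact: W'W].
rewrite -[x](subrK p) (perp_self (wandering_part_sub Wz)) ?add0r//.
have M0 := subspace0 (closed_subspace_subspace cM).
apply: (homogeneous_ind hM (S := [set y | hdot y (x - p) = 0])).
  exact: closed_subspace_perp.
move=> k y My ky /=.
have [|G GM GP] := wandering_decomposition cM invM hM (k := k).
  by move=> j _; exact: fin_generated_homogeneous_part.
have [u [Wu ku yu]] := GP y My ky.
rewrite -[y](subrK u) hdotDl (pP u); last by apply: sub_gen_smallest; exists k.
rewrite addr0; apply: (yu [set v | hdot v (x - p) = 0]); split.
  exact/closed_subspace_subspace/closed_subspace_perp.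
move=> _ /GM[i [j [v [_ Mv _ ->]]]].
exact: ((wandering_partP _ M0).1 Wz).2.
Qed.

Lemma wandering_span_part M : closed_subspace M -> Defs.invariant T M ->
  homogeneous Hk M -> wandering_span T (wandering_part T M) = M.
Proof.
move=> cM invM hM; apply/seteqP; split.
  by apply: wandering_span_sub => //; exact: wandering_part_sub.
have cS := closed_subspace_wandering_span (wandering_part T M).
apply: (homogeneous_ind hM) => // k x Mx kx.
apply: (homogeneous_part_sub cM invM hM (k := k)) => //.
- exact: closed_subspace_subspace.
- exact: invariant_wandering_span.
- exact: sub_wandering_span.
Qed.

(** [wandering_part_span] presupposes that [W] is finite dimensional. This is obtained first, from
    the inclusion of [W] in the wandering part of its span. *)
Lemma homogeneous_wandering_finite W : homogeneous_wandering Hk T W ->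
  exists m, has_dim W m.
Proof.
move=> [wW hW].
have [m Wm] : exists m, has_dim (wandering_part T (wandering_span T W)) m.
  apply: wandering_part_finite; first exact: closed_subspace_span.
    exact: invariant_wandering_span.
  exact: homogeneous_wandering_span.
rewrite -(wandering_part_span wW); first by exists m.
apply: fin_generatedS (has_dim_fin_generated Wm).
  exact: closed_subspace_subspace wW.1.
exact: wandering_sub_part.
Qed.

End FiniteCodimension.

(** In the topological and the algebraic case a finite family generates [H] as a closed invariant
    subspace, so [wandering_part_dim] applies. *)
Lemma fg_graded_codim : fg_graded Hk gamma T ->
  exists d, has_dim (wandering_part T [set: H]) d.
Proof.
move=> [_ [[l [x xH]]|//|[l [x [_ xH]]]]];
  have [||||d _ ?] := @wandering_part_dim [set: H] l x; try by exists d.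
- exact: closed_subspace_setT.
- by move=> i y.
- by [].
- by move=> S cS invS xS; rewrite xH; apply: smallest_sub => // _ [j _ <-].
- exact: closed_subspace_setT.
- by move=> i y.
- by [].
move=> S cS invS xS; apply: (homogeneous_ind homogeneousT) => // k y _ ky.
have : algebraic_sum Hk y.
  (* Length [k.+1] is what makes the sum reach the index [k], the only one with a nonzero term. *)
  exists k.+1, (fun j => if j == k then y else 0); split.
    by move=> j; case: eqVneq => [->//|_]; exact: subspace0 (lin_subspace_Hk j).
  rewrite (bigD1 ord_max)//= eqxx big1 ?addr0// => j /negPf jk.
  by rewrite -[k]/(nat_of_ord (@ord_max k)) (inj_eq val_inj) jk.
have sS := closed_subspace_subspace cS.
rewrite xH => -[p _ <-]; apply: subspace_sum => // j _.
exact: tpoly_invariant.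
Qed.

End Graded.

End Tuples.

(** * The bijection and the cyclicity of restrictions *)

Theorem corollary2p4 (R : realType) (H : hilbertType R) (Hk : nat -> set H)
  (hH : orthogonal_decomposition Hk)
  (n : nat) (gamma : 'I_n -> nat) (hgamma : forall i, (0 < gamma i)%N)
  (T : 'I_n -> {linear H -> H})
  (hTb : bounded_tuple T) (hTc : commuting T) (hT : fg_graded Hk gamma T) :
  [/\ set_bij (homogeneous_wandering Hk T) (homogeneous_invariant Hk T)
        (wandering_span T),
      {in homogeneous_wandering Hk T,
        cancel (wandering_span T) (wandering_part T)} &
      {in homogeneous_invariant Hk T,
        cancel (wandering_part T) (wandering_span T)}]
  /\
  (forall W, homogeneous_wandering Hk T W -> finite_dim W) /\
  (forall M, homogeneous_invariant Hk T M ->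
     exists N, has_dim (wandering_part T M) N /\ cyclic_on T M N).
Proof.
have [d dim_WH] := fg_graded_codim hH hT; have [hdeg _] := hT.
have span_inv W : homogeneous_wandering Hk T W ->
    homogeneous_invariant Hk T (wandering_span T W).
  move=> [wW hW]; split; first exact: closed_subspace_span.
    exact: invariant_wandering_span.
  exact: (homogeneous_wandering_span hTb hTc hdeg).
have part_wand M : homogeneous_invariant Hk T M ->
    homogeneous_wandering Hk T (wandering_part T M).
  move=> [cM invM hM]; split; first exact: wandering_wandering_part.
  exact: (homogeneous_wandering_part hTb hTc hH hgamma hdeg dim_WH).
have finW W : homogeneous_wandering Hk T W -> exists m, has_dim W m.
  exact: (homogeneous_wandering_finite hTb hTc hH hgamma hdeg dim_WH).
have spanK W : homogeneous_wandering Hk T W ->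
    wandering_part T (wandering_span T W) = W.
  move=> hW; have [m Wm] := finW W hW.
  by apply: (wandering_part_span hTb hTc hW.1); exact: has_dim_fin_generated Wm.
have partK M : homogeneous_invariant Hk T M ->
    wandering_span T (wandering_part T M) = M.
  move=> [cM invM hM].
  exact: (wandering_span_part hTb hTc hH hgamma hdeg dim_WH).
split; [split|split=> [//|M hM]].
- split=> [W|W W'|M hM]; first exact: span_inv.
    by rewrite !inE => /spanK {2}<- /spanK {2}<- ->.
  by exists (wandering_part T M); [exact: part_wand|exact: partK].
- by move=> W; rewrite inE; exact: spanK.
- by move=> M; rewrite inE; exact: partK.
have [cM invM _] := hM; have sM := closed_subspace_subspace cM.
have exW : exists N, `[< has_dim (wandering_part T M) N >].
  by have [N WN] := finW _ (part_wand M hM); exists N; exact/asboolP.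
(* The least [N] replaces an appeal to the uniqueness of dimension: a generating family of size [N']
   yields some dimension [m <= N'], and [N <= m]. *)
case: (ex_minnP exW) => N /asboolP dimW Nmin; exists N; split=> //.
split; last first.
  move=> N' /(generatesP cM invM)[m mN' Wm]; apply: leq_trans mN'.
  by apply: Nmin; exact/asboolP.
have [e [e_free We]] := dimW; exists e.
have eW j : wandering_part T M (e j).
  by rewrite We; exact: lin_comb_basis.
split=> [j|]; first exact: wandering_part_sub (eW j).
apply/seteqP; split.
  apply: smallest_sub => // _ [[p j] _ <-].
  by apply: tpoly_invariant => //; exact: wandering_part_sub (eW j).
(* As [M] is the span of its wandering part, it suffices by linearity to reach each T^k applied to a
   basis vector [e j], and this is a monomial acting on [e j]. *)
rewrite -[X in X `<=` _](partK M hM).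
have cS := closed_subspace_span
  [set tpoly T q.1 (e q.2) | q in [set: mpoly.mpoly n R[i] * 'I_N]].
apply: smallest_sub => // _ [k _ [w + <-]]; rewrite We => -[c _ <-].
have sS := closed_subspace_subspace (closed_subspace_tpow hTb k cS).
apply: (subspace_sum _ sS) => j _; apply: (subspaceZ _ sS).
rewrite /= -tpolyX; apply: sub_gen_smallest.
by exists (mpoly.mpolyX R[i] (mpoly.Multinom [tuple k i | i < n]), j).
Qed.
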